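(* Let $(\rho,\eta)\Gamma$ be a $(\rho,\eta)$-connection for the vector bundle $(E,\pi,M)$ and let $((\rho,\eta)H,(\rho,\eta)V)$ be a distinguished linear $(\rho,\eta)$-connection, with covariant derivative $D=(\rho,\eta)D$ and curvature $\mathbb R=(\rho,\eta,h)\mathbb R$, for the generalized tangent bundle $((\rho,\eta)TE,(\rho,\eta)\tau_E,E)$. Write $[\,,]=[\,,]_{(\rho,\eta)TE}$. Then for all sections $X,Y,Z$ of $(\rho,\eta)TE$: $$D_{\mathcal HX}D_{\mathcal HY}\mathcal HZ-D_{\mathcal HY}D_{\mathcal HX}\mathcal HZ=\mathbb R(\mathcal HX,\mathcal HY)\mathcal HZ+D_{\mathcal H[\mathcal HX,\mathcal HY]}\mathcal HZ+D_{\mathcal V[\mathcal HX,\mathcal HY]}\mathcal HZ,$$ $$D_{\mathcal VX}D_{\mathcal HY}\mathcal HZ-D_{\mathcal HY}D_{\mathcal VX}\mathcal HZ=\mathbb R(\mathcal VX,\mathcal HY)\mathcal HZ+D_{\mathcal H[\mathcal VX,\mathcal HY]}\mathcal HZ+D_{\mathcal V[\mathcal VX,\mathcal HY]}\mathcal HZ,$$ $$D_{\mathcal VX}D_{\mathcal VY}\mathcal HZ-D_{\mathcal VY}D_{\mathcal VX}\mathcal HZ=\mathbb R(\mathcal VX,\mathcal VY)\mathcal HZ+D_{\mathcal V[\mathcal VX,\mathcal VY]}\mathcal HZ,$$ and $$D_{\mathcal HX}D_{\mathcal HY}\mathcal VZ-D_{\mathcal HY}D_{\mathcal HX}\mathcal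 VZ=\mathbb R(\mathcal HX,\mathcal HY)\mathcal VZ+D_{\mathcal H[\mathcal HX,\mathcal HY]}\mathcal VZ+D_{\mathcal V[\mathcal HX,\mathcal HY]}\mathcal VZ,$$ $$D_{\mathcal VX}D_{\mathcal HY}\mathcal VZ-D_{\mathcal HY}D_{\mathcal VX}\mathcal VZ=\mathbb R(\mathcal VX,\mathcal HY)\mathcal VZ+D_{\mathcal H[\mathcal VX,\mathcal HY]}\mathcal VZ+D_{\mathcal V[\mathcal VX,\mathcal HY]}\mathcal VZ,$$ $$D_{\mathcal VX}D_{\mathcal VY}\mathcal VZ-D_{\mathcal VY}D_{\mathcal VX}\mathcal VZ=\mathbb R(\mathcal VX,\mathcal VY)\mathcal VZ+D_{\mathcal V[\mathcal VX,\mathcal VY]}\mathcal VZ.$$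
   Context: Setting. $M$ is a smooth $m$-manifold, $(E,\pi,M)$ a smooth real vector bundle of rank $r$, $h,\eta:M\to M$ diffeomorphisms, and $((E,\pi,M),[\,,]_{E,h},(\rho,\eta))$ is a generalized Lie algebroid: $(\rho,\eta)$ is a vector bundle morphism from $(E,\pi,M)$ to $(TM,\tau_M,M)$ covering $\eta$, and $[\,,]_{E,h}$ is a Lie bracket on $\Gamma(E,\pi,M)$ with $[u,fv]_{E,h}=f[u,v]_{E,h}+(\Gamma(Th\circ\rho,h\circ\eta)(u)f)\,v$, where $\Gamma(Th\circ\rho,h\circ\eta)(u)$ is the vector field $Th\circ\rho\circ u\circ(h\circ\eta)^{-1}$ on $M$. The summation convention is used. In a vector bundle chart with coordinates $(x^i,y^a)$ on $E$ and local frame $(s_a)$, $[s_a,s_b]_{E,h}=L^c_{ab}s_c$, $\rho^i_a$ are the components of $\rho$ ($\rho(s_a)=\rho_a^i\,\partial/\partial x^i$), $\partial_i=\partial/\partial x^i$ and $\dot\partial_a=\partial/\partial y^a$ on $E$. Generalized tangent bundle. $(\rho,\eta)TE$ is the rank $2r$ vector subbundle of $(h\circ\pi)^*E\oplus TE$ over $E$ with local frame (natural base) $\tilde\partial_a=S_a\oplus(\rho^i_a\circ h\circ\pi)\partial_i$, $\dot{\tilde\partial}_a=0\oplus\dot\partial_a$, where $(S_a)$ is the frame of $(h\circ\pi)^*E$ induced by $(s_a)$. It is a Lie algebroid over $E$ with anchor $\tilde\rho(\tilde\partial_a)=(\rho^i_a\circ h\circ\pi)\partial_i$, $\tilde\rho(\dot{\tilde\partial}_a)=\dot\partial_a$,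 and bracket $[\,,]_{(\rho,\eta)TE}$ determined by the Leibniz rule and $[\tilde\partial_a,\tilde\partial_b]=(L^c_{ab}\circ h\circ\pi)\tilde\partial_c$, $[\tilde\partial_a,\dot{\tilde\partial}_b]=0$, $[\dot{\tilde\partial}_a,\dot{\tilde\partial}_b]=0$. Connection. The vertical subbundle is spanned by the $\dot{\tilde\partial}_a$. A $(\rho,\eta)$-connection $(\rho,\eta)\Gamma$ is a left splitting of its inclusion, $X^c\tilde\partial_c+\tilde X^a\dot{\tilde\partial}_a\mapsto(\tilde X^a+(\rho,\eta)\Gamma^a_cX^c)\dot{\tilde\partial}_a$; the horizontal subbundle is its kernel, spanned by $\tilde\delta_a=\tilde\partial_a-(\rho,\eta)\Gamma^b_a\dot{\tilde\partial}_b$. $\mathcal H$ and $\mathcal V$ are the projectors onto the horizontal and vertical subbundles: $\mathcal H\tilde\delta_a=\tilde\delta_a$, $\mathcal H\dot{\tilde\partial}_a=0$, $\mathcal V=\mathrm{Id}-\mathcal H$. A distinguished linear $(\rho,\eta)$-connection is a linear covariant derivative $(\rho,\eta)D$ on $(\rho,\eta)TE$ (along sections of the Lie algebroid $(\rho,\eta)TE$: $\mathcal F(E)$-linear in the lower argument, and $D_X(fY)=(\tilde\rho(X)f)Y+fD_XY$) which preserves the horizontal and the vertical subbundles by parallelism ($D_X$ maps horizontal sections to horizontal sections and vertical sections to vertical sections). Its curvature is $(\rho,\eta,h)\mathbb R(Y,Z)X=D_YD_ZX-D_ZD_YX-D_{[Y,Z]_{(\rho,\eta)TE}}X$. *)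

(* Defs.v *)
From HB Require Import structures.
From mathcomp Require Import all_boot all_order all_algebra.
From mathcomp Require Import boolp classical_sets functions reals topology.
From mathcomp Require Import normedtype derive.

Set Implicit Arguments.
Unset Strict Implicit.
Unset Printing Implicit Defensive.

Import Order.TTheory GRing.Theory Num.Theory numFieldNormedType.Exports.

Local Open Scope classical_set_scope.
Local Open Scope ring_scope.

Section Smooth.
Context {R : realType} {n : nat} {W : normedModType R}.

(* [U] is meant to be open. *)
Fixpoint class_C (k : nat) (U : set 'rV[R]_n) (f : 'rV[R]_n -> W) : Prop :=
  match k with
  | 0%N => forall x, U x -> {for x, continuous f}
  | k'.+1 => (forall x, U x -> differentiable f x) /\
             (forall v, class_C k' U (fun x => 'D_v f x))
  end.

Definition smooth_on (U : set 'rV[R]_n) (f : 'rV[R]_n -> W) : Prop :=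
  forall k, class_C k U f.

End Smooth.

(* A chart is a bijection [cmap] from [cdom] onto an open subset of R^n with
   inverse [cinv]; off [cdom] and off the image the values are irrelevant.  No
   topology is assumed on [X]: as usual it is the one induced by the atlas. *)
Record chart (R : realType) (X : Type) (n : nat) := Chart {
  cdom : set X;
  cmap : X -> 'rV[R]_n;
  cinv : 'rV[R]_n -> X }.

Record charted (R : realType) (n : nat) := Charted {
  points :> Type;
  atlas : set (chart R points n) }.
Arguments atlas {R n}.

Section Manifold.
Context {R : realType} {n : nat}.

Definition mopen (X : charted R n) (O : set X) : Prop :=
  forall c, atlas X c -> open (cmap c @` (O `&` cdom c)).

(* [f] is smooth on the open set [O], in coordinates. *)
Definition smooth_fun (W : normedModType R) (X : charted R n) (O : set X)
    (f : X -> W) : Prop :=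
  forall c, atlas X c -> smooth_on (cmap c @` (O `&` cdom c)) (f \o cinv c).

Record is_smooth_manifold (X : charted R n) : Prop := IsSmoothManifold {
  mfd_cover : forall p : X, exists c, atlas X c /\ cdom c p;
  mfd_cmapK : forall c p, atlas X c -> cdom c p -> cinv c (cmap c p) = p;
  mfd_open : forall c c', atlas X c -> atlas X c' ->
    open (cmap c @` (cdom c' `&` cdom c));
  mfd_smooth : forall c c', atlas X c -> atlas X c' ->
    smooth_on (cmap c @` (cdom c' `&` cdom c)) (cmap c' \o cinv c);
  mfd_hausdorff : forall p q : X, p <> q ->
    exists O O' : set X,
      [/\ mopen O, mopen O', O p, O' q & O `&` O' = set0];
  mfd_second_countable : exists B : nat -> set X,
    (forall k, mopen (B k)) /\
    (forall (O : set X) p, mopen O -> O p -> exists k, B k p /\ B k `<=` O) }.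

(* A tangent vector at [p] is given by its components [w c] in the charts [c]
   around [p], which are related by the Jacobians of the changes of
   coordinates; the components in the other charts are 0 by convention, so that
   tangent vectors at all points live in the single R-module [tvec X]. *)
Definition tvec (X : charted R n) : Type := chart R X n -> 'rV[R]_n.

HB.instance Definition _ (X : charted R n) :=
  GRing.Lmodule.copy (tvec X) (chart R X n -> 'rV[R]_n).

Definition tangent (X : charted R n) (p : X) (w : tvec X) : Prop :=
  (forall c, ~ (atlas X c /\ cdom c p) -> w c = 0) /\
  (forall c c', atlas X c -> cdom c p -> atlas X c' -> cdom c' p ->
    w c' = 'D_(w c) (cmap c' \o cinv c) (cmap c p)).

(* The tangent vector at [p] whose components in the chart [c] are [v], i.e.
   v^i d/dx^i. *)
Definition coord_vec (X : charted R n) (c : chart R X n) (p : X)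
    (v : 'rV[R]_n) : tvec X :=
  fun c' => if `[< atlas X c' /\ cdom c' p >]
            then 'D_v (cmap c' \o cinv c) (cmap c p) else 0.

Definition chart_at (X : charted R n) (p : X) : chart R X n :=
  match pselect (exists c, atlas X c /\ cdom c p) with
  | left H => projT1 (cid H)
  | right _ => Chart setT (fun=> 0) (fun=> p)
  end.

(* [w f], for a tangent vector [w] at [p]. *)
Definition tder (X : charted R n) (p : X) (w : tvec X) (f : X -> R^o) : R :=
  let c := chart_at p in 'D_(w c) (f \o cinv c) (cmap c p).

End Manifold.

Section Maps.
Context {R : realType} {n k : nat} {X : charted R n} {Y : charted R k}.

Definition smooth_map (f : X -> Y) : Prop :=
  (forall O : set Y, mopen O -> mopen (f @^-1` O)) /\
  (forall c c', atlas X c -> atlas Y c' ->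
    smooth_on (cmap c @` (f @^-1` cdom c' `&` cdom c))
              (cmap c' \o f \o cinv c)).

(* [tmap f p] is the tangent map T_p X -> T_(f p) Y. *)
Definition tmap (f : X -> Y) (p : X) (w : tvec X) : tvec Y :=
  fun c' => if `[< atlas Y c' /\ cdom c' (f p) >]
            then let c := chart_at p in
                 'D_(w c) (cmap c' \o f \o cinv c) (cmap c p)
            else 0.

End Maps.

Record diffeo (R : realType) (n : nat) (X : charted R n) := Diffeo {
  dmap :> X -> X;
  dinv : X -> X;
  dmapK : cancel dmap dinv;
  dinvK : cancel dinv dmap;
  dmap_smooth : smooth_map dmap;
  dinv_smooth : smooth_map dinv }.

(* A vector bundle chart over [vdom] consists of linear isomorphisms [vmap x]
   from the fibres onto R^r, with inverses [vinv x]. *)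
Record vbchart (R : realType) (B : Type) (F : B -> lmodType R) (r : nat) :=
  VBChart {
    vdom : set B;
    vmap : forall x, F x -> 'rV[R]_r;
    vinv : forall x, 'rV[R]_r -> F x }.

Record vbundle (R : realType) (m : nat) (M : charted R m) (r : nat) :=
  VBundle {
    fiber :> M -> lmodType R;
    vbatlas : set (vbchart fiber r) }.
Arguments vbatlas {R m M r}.

Section VectorBundle.
Context {R : realType} {m r : nat} {M : charted R m}.
Context (E : vbundle M r).

Record is_vector_bundle : Prop := IsVectorBundle {
  vb_cover : forall x : M, exists t, vbatlas E t /\ vdom t x;
  vb_open : forall t, vbatlas E t -> mopen (vdom t);
  vb_linear : forall t x a (u v : E x), vbatlas E t -> vdom t x ->
    vmap t (a *: u + v) = a *: vmap t u + vmap t v;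
  vb_vmapK : forall t x (u : E x), vbatlas E t -> vdom t x ->
    vinv t x (vmap t u) = u;
  vb_vinvK : forall t x y, vbatlas E t -> vdom t x ->
    vmap t (vinv t x y) = y;
  vb_smooth : forall t t' y, vbatlas E t -> vbatlas E t' ->
    smooth_fun (vdom t `&` vdom t') (fun x => vmap t' (vinv t x y)) }.

(* The local frame s_a of a vector bundle chart. *)
Definition local_frame (t : vbchart E r) (a : 'I_r) (x : M) : E x :=
  vinv t x (delta_mx 0 a).

Definition smooth_sec (u : forall x, E x) : Prop :=
  forall t, vbatlas E t -> smooth_fun (vdom t) (fun x => vmap t (u x)).

(* The total space, with the charts (x^i, y^a). *)
Definition bproj (p : {x : M & E x}) : M := projT1 p.

Definition total_chart (c : chart R M m) (t : vbchart E r) :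
    chart R {x : M & E x} (m + r) :=
  Chart
    [set p | cdom c (bproj p) /\ vdom t (bproj p)]
    (fun p => row_mx (cmap c (bproj p)) (vmap t (projT2 p)))
    (fun z => existT (fun x => E x) (cinv c (lsubmx z))
                (vinv t (cinv c (lsubmx z)) (rsubmx z))).

Definition total_space : charted R (m + r) :=
  Charted [set k | exists c t,
    [/\ atlas M c, vbatlas E t & k = total_chart c t]].

End VectorBundle.

Section GeneralizedLieAlgebroid.
Context {R : realType} {m r : nat} {M : charted R m} (E : vbundle M r).
Context (h eta : diffeo M).
Context (rho : forall x : M, E x -> tvec M).
Context (brE : (forall x, E x) -> (forall x, E x) -> forall x, E x).

(* The vector field Th o rho o u o (h o eta)^-1. *)
Definition anchor_field (u : forall x, E x) (y : M) : tvec M :=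
  let x := dinv eta (dinv h y) in tmap h (eta x) (rho (u x)).

Record is_gen_lie_algebroid : Prop := IsGenLieAlgebroid {
  gla_tangent : forall x (e : E x), tangent (eta x) (rho e);
  gla_linear : forall x a (e e' : E x),
    rho (a *: e + e') = a *: rho e + rho e';
  gla_smooth : forall t c y, vbatlas E t -> atlas M c ->
    smooth_fun (vdom t `&` eta @^-1` cdom c)
      (fun x => rho (vinv t x y : E x) c);
  gla_sec : forall u v, smooth_sec u -> smooth_sec v -> smooth_sec (brE u v);
  gla_bilinear : forall a u u' v,
    smooth_sec u -> smooth_sec u' -> smooth_sec v -> forall x,
    brE (fun z => a *: u z + u' z) v x = a *: brE u v x + brE u' v x;
  gla_skew : forall u v, smooth_sec u -> smooth_sec v -> forall x,
    brE u v x = - brE v u x;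
  gla_jacobi : forall u v w,
    smooth_sec u -> smooth_sec v -> smooth_sec w -> forall x,
    brE u (brE v w) x + brE v (brE w u) x + brE w (brE u v) x = 0;
  gla_leibniz : forall (f : M -> R^o) u v,
    smooth_fun setT f -> smooth_sec u -> smooth_sec v -> forall x,
    brE u (fun z => f z *: v z) x
    = f x *: brE u v x + tder x (anchor_field u x) f *: v x }.

(* L^c_ab for the frame s_a of [t].  As [brE] acts on global sections, the
   bracket [s_a, s_b] at [x] is that of any global sections which coincide
   with s_a and s_b near [x]. *)
Definition structure_functions (t : vbchart E r)
    (L : 'I_r -> 'I_r -> 'I_r -> M -> R) : Prop :=
  forall a b (u v : forall x, E x) (O : set M),
    smooth_sec u -> smooth_sec v -> mopen O -> O `<=` vdom t ->
    (forall x, O x -> u x = local_frame t a x /\ v x = local_frame t b x) ->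
    forall x, O x -> brE u v x = \sum_(c < r) L a b c x *: local_frame t c x.

Local Notation TotE := (total_space E).

(* The fibre at [p] of (h o pi)^* E (+) TE. *)
Local Notation amb p := (E (h (bproj p)) * tvec TotE)%type.

(* Not necessarily continuous sections, defined over all of E. *)
Definition gsection := forall p : TotE, amb p.

(* A natural base around [p] is given by a chart [c] of M around pi(p) (the
   coordinates x^i), a chart [t] of the bundle around pi(p) (the coordinates
   y^a) and a chart [s] of the bundle around h(pi(p)) (the frame s_a).  One
   bundle chart in general does not cover both points. *)
Definition nat_dom (c : chart R M m) (t s : vbchart E r) : set TotE :=
  [set p | [/\ cdom c (bproj p), vdom t (bproj p) & vdom s (h (bproj p))]].

Definition nat_charts (c : chart R M m) (t s : vbchart E r) : Prop :=
  [/\ atlas M c, vbatlas E t & vbatlas E s].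

(* rho^i_a o h o pi.  The vector rho(s_a(h(pi(p)))) is tangent at
   eta(h(pi(p))), and its components are taken in the chart [c] around pi(p):
   the Leibniz rule forces rho to vanish on the fibre over h(pi(p)) unless
   eta(h(pi(p))) = pi(p). *)
Definition rho_comp (c : chart R M m) (s : vbchart E r) (i : 'I_m) (a : 'I_r)
    (p : TotE) : R :=
  rho (local_frame s a (h (bproj p))) c 0 i.

Definition dtilde (c : chart R M m) (t s : vbchart E r) (a : 'I_r) : gsection :=
  fun p => (local_frame s a (h (bproj p)),
            \sum_(i < m) rho_comp c s i a p *:
              (coord_vec (total_chart c t : chart R TotE (m + r)) p
                 (row_mx (delta_mx 0 i) 0) : tvec TotE)).

Definition ddot (c : chart R M m) (t : vbchart E r) (a : 'I_r) : gsection :=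
  fun p => (0, coord_vec (total_chart c t : chart R TotE (m + r)) p
                 (row_mx 0 (delta_mx 0 a))).

(* The fibre at [p] of (rho, eta)TE: the span of the natural base. *)
Definition gtb (p : TotE) (z : amb p) : Prop :=
  forall c t s, nat_charts c t s -> nat_dom c t s p ->
  exists x y : 'I_r -> R,
    z = \sum_(a < r) x a *: dtilde c t s a p
        + \sum_(a < r) y a *: ddot c t a p.

Definition vertical (p : TotE) (z : amb p) : Prop :=
  forall c t s, nat_charts c t s -> nat_dom c t s p ->
  exists y : 'I_r -> R, z = \sum_(a < r) y a *: ddot c t a p.

(* [X] restricts to a smooth section of (rho, eta)TE over the open set [O]. *)
Definition gtb_section (O : set TotE) (X : gsection) : Prop :=
  [/\ forall p, O p -> gtb (X p),
      forall s, vbatlas E s ->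
        smooth_fun (O `&` [set p : TotE | vdom s (h (bproj p))])
          (fun p : TotE => vmap s (X p).1)
    & forall k, atlas TotE k ->
        smooth_fun (O `&` cdom k) (fun p : TotE => (X p).2 k)].

(* (rho~(X) f)(p) *)
Definition ganchor (X : gsection) (f : TotE -> R^o) (p : TotE) : R :=
  tder p (X p).2 f.

(* The Lie algebroid bracket of (rho, eta)TE.  As it is specified on local
   frames, it is taken on the sections over every open set [O], compatibly with
   restrictions: [br X Y p] only depends on the germs of [X] and [Y] at [p]. *)
Record is_gtb_bracket (br : gsection -> gsection -> gsection) : Prop :=
  IsGtbBracket {
    gbr_sec : forall O X Y, mopen O -> gtb_section O X -> gtb_section O Y ->
      gtb_section O (br X Y);
    gbr_local : forall O X X' Y Y', mopen O ->
      gtb_section O X -> gtb_section O Y ->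
      (forall p, O p -> X p = X' p) -> (forall p, O p -> Y p = Y' p) ->
      forall p, O p -> br X Y p = br X' Y' p;
    gbr_bilinear : forall O a X X' Y, mopen O ->
      gtb_section O X -> gtb_section O X' -> gtb_section O Y ->
      forall p, O p ->
      br (fun q => a *: X q + X' q) Y p = a *: br X Y p + br X' Y p;
    gbr_skew : forall O X Y, mopen O -> gtb_section O X -> gtb_section O Y ->
      forall p, O p -> br X Y p = - br Y X p;
    gbr_jacobi : forall O X Y Z, mopen O ->
      gtb_section O X -> gtb_section O Y -> gtb_section O Z ->
      forall p, O p ->
      br X (br Y Z) p + br Y (br Z X) p + br Z (br X Y) p = 0;
    gbr_leibniz : forall O (f : TotE -> R^o) X Y, mopen O ->
      smooth_fun O f -> gtb_section O X -> gtb_section O Y ->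
      forall p, O p ->
      br X (fun q => f q *: Y q) p = f p *: br X Y p + ganchor X f p *: Y p;
    gbr_dtilde : forall c t s L a b p, nat_charts c t s ->
      structure_functions s L -> nat_dom c t s p ->
      br (dtilde c t s a) (dtilde c t s b) p
      = \sum_(d < r) L a b d (h (bproj p)) *: dtilde c t s d p;
    gbr_dtilde_ddot : forall c t s a b p, nat_charts c t s ->
      nat_dom c t s p -> br (dtilde c t s a) (ddot c t b) p = 0;
    gbr_ddot : forall c t s a b p, nat_charts c t s ->
      nat_dom c t s p -> br (ddot c t a) (ddot c t b) p = 0 }.

(* A (rho, eta)-connection: a smooth vector bundle morphism from (rho, eta)TE
   to its vertical subbundle which is the identity on the latter. *)
Record is_connection (G : forall p : TotE, amb p -> amb p) : Prop :=
  IsConnection {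
    conn_linear : forall p a (z z' : amb p), gtb z -> gtb z' ->
      G p (a *: z + z') = a *: G p z + G p z';
    conn_vertical : forall p (z : amb p), gtb z -> vertical (G p z);
    conn_split : forall p (z : amb p), vertical z -> G p z = z;
    conn_smooth : forall O X, mopen O -> gtb_section O X ->
      gtb_section O (fun p => G p (X p)) }.

Section Connection.
Context (G : forall p : TotE, amb p -> amb p).

Definition horizontal (p : TotE) (z : amb p) : Prop := gtb z /\ G z = 0.

Definition hproj (X : gsection) : gsection := fun p => X p - G (X p).

Definition vproj (X : gsection) : gsection := fun p => X p - hproj X p.

(* The covariant derivative of a distinguished linear (rho, eta)-connection. *)
Record is_distinguished (D : gsection -> gsection -> gsection) : Prop :=
  IsDistinguished {
    dl_sec : forall X Y, gtb_section setT X -> gtb_section setT Y ->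
      gtb_section setT (D X Y);
    dl_linear : forall (f : TotE -> R^o) X X' Y, smooth_fun setT f ->
      gtb_section setT X -> gtb_section setT X' -> gtb_section setT Y ->
      forall p, D (fun q => f q *: X q + X' q) Y p
                = f p *: D X Y p + D X' Y p;
    dl_additive : forall X Y Y',
      gtb_section setT X -> gtb_section setT Y -> gtb_section setT Y' ->
      forall p, D X (fun q => Y q + Y' q) p = D X Y p + D X Y' p;
    dl_leibniz : forall (f : TotE -> R^o) X Y, smooth_fun setT f ->
      gtb_section setT X -> gtb_section setT Y ->
      forall p, D X (fun q => f q *: Y q) p
                = ganchor X f p *: Y p + f p *: D X Y p;
    dl_horizontal : forall X Y, gtb_section setT X -> gtb_section setT Y ->
      (forall p, horizontal (Y p)) -> forall p, horizontal (D X Y p);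
    dl_vertical : forall X Y, gtb_section setT X -> gtb_section setT Y ->
      (forall p, vertical (Y p)) -> forall p, vertical (D X Y p) }.

End Connection.

Definition curvature (br D : gsection -> gsection -> gsection)
    (Y Z X : gsection) : gsection :=
  fun p => D Y (D Z X) p - D Z (D Y X) p - D (br Y Z) X p.

End GeneralizedLieAlgebroid.

(* Main.v *)
(* Each identity says that D_[A, B] = D_(H [A, B]) + D_(V [A, B]) for
   A, B in {HX, VX, HY, VY}, which is additivity of D in its lower argument.
   The two identities for A = VX and B = VY lack the horizontal term: they use
   moreover that the vertical subbundle is involutive.  This is a local
   question: near a point a vertical section is a combination of the frame
   [ddot] with smooth coefficients, and as the brackets of this frame vanish,
   the Leibniz rule gives the claim. *)
Require Import Defs.
From HB Require Import structures.
From mathcomp Require Import all_boot all_order all_algebra.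
From mathcomp Require Import boolp classical_sets functions reals topology.
From mathcomp Require Import normedtype landau derive.

Import GRing.Theory numFieldNormedType.Exports.
Local Open Scope classical_set_scope.
Local Open Scope ring_scope.

Set Implicit Arguments.
Unset Strict Implicit.
Unset Printing Implicit Defensive.

(** The source is finite dimensional: in the standard basis, [L] is a finite sum of coordinate
    functions times fixed vectors of [W]. *)
Lemma linear_rV_continuous (R : realType) n (W : normedModType R)
    (L : {linear 'rV[R]_n -> W}) : continuous L.
Proof.
have -> : (L : _ -> _) = fun w => \sum_(j < n) w 0 j *: L (delta_mx 0 j).
  apply: funext => w; rewrite {1}[w]row_sum_delta linear_sum.
  by apply: eq_bigr => j _; rewrite linearZ.
apply: continuous_big => [|j _ w]; first exact: add_continuous.
by apply: continuousZr_tmp; exact: coord_continuous.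
Qed.

(** * Smooth maps on open subsets of R^n *)

Section SmoothOn.
Context {R : realType} {n : nat}.
Implicit Types (U : set 'rV[R]_n) (W : normedModType R).

Lemma smooth_on_sub W U U' (f : 'rV[R]_n -> W) :
  U' `<=` U -> smooth_on U f -> smooth_on U' f.
Proof.
move=> sub fs k; move: (fs k); elim: k f {fs} => [|k IH] f /=.
  by move=> fc x /sub /fc.
by move=> [fd fD]; split=> [x /sub /fd//|v]; exact: IH.
Qed.

Lemma smooth_on_diff W U (f : 'rV[R]_n -> W) :
  smooth_on U f -> forall x, U x -> differentiable f x.
Proof. by move=> /(_ 1%N) []. Qed.

Lemma smooth_on_derive W U (f : 'rV[R]_n -> W) v :
  smooth_on U f -> smooth_on U (fun x => 'D_v f x).
Proof. by move=> fs k; have [_] := fs k.+1; exact. Qed.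

Lemma eq_near_on (T : Type) U (f g : 'rV[R]_n -> T) x : open U -> U x ->
  (forall y, U y -> f y = g y) -> \forall y \near x, f y = g y.
Proof.
move=> oU Ux fg; near=> y; apply: fg; near: y.
exact: open_nbhs_nbhs.
Unshelve. all: by end_near. Qed.

(** Differentiability depends only on the germ: the first-order expansion of [f] at [x], with its
    linear part, is also one for [g]. *)
Lemma eq_near_differentiable (V W : normedModType R) (f g : V -> W) x :
  (\forall y \near x, f y = g y) -> differentiable f x -> differentiable g x.
Proof.
move=> fg /diff_locallyP [c E].
have E' : g \o shift x = cst (g x) + 'd f x +o_ 0 id.
  apply/eqaddoP => e e0; move/eqaddoP: E => /(_ e e0) E.
  have fg0 : \forall y \near (0 : V), f (y + x) = g (y + x).
    move: fg; rewrite (near_shift 0) /= => fg; by rewrite subr0 in fg.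
  near=> y.
  have -> : (g \o shift x - (cst (g x) + 'd f x)) y =
            (f \o shift x - (cst (f x) + 'd f x)) y.
    rewrite !fctE /= (nbhs_singleton fg); congr (_ - _).
    by apply/esym; near: y; exact: fg0.
  by near: y; exact: E.
(* Uniqueness of the differential identifies ['d g x] with the continuous linear part ['d f x] of
   the expansion. *)
by apply/diff_locallyP; rewrite (diff_unique c E').
Unshelve. all: by end_near. Qed.

(** Since [U] is open, equality on [U] is equality of germs at each of its points. It thus passes to
    the directional derivatives, and the induction proceeds. *)
Lemma eq_class_C W U k (f g : 'rV[R]_n -> W) : open U ->
  (forall x, U x -> f x = g x) -> class_C k U f -> class_C k U g.
Proof.
move=> oU; elim: k f g => [|k IH] f g fg /=.
  move=> fc x Ux; suff : g @ x --> g x by [].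
  rewrite -(fg x Ux).
  apply: cvg_trans (fc x Ux); apply: (@near_eq_cvg _ _ (nbhs x)).
  exact: (eq_near_on oU Ux fg).
move=> [fd fD]; split=> [x Ux|v]; last first.
  apply: IH (fD v) => x Ux; apply: near_eq_derive; exact: (eq_near_on oU Ux fg).
have e := eq_near_on oU Ux fg.
exact: eq_near_differentiable e (fd x Ux).
Qed.

Lemma eq_smooth_on W U (f g : 'rV[R]_n -> W) : open U ->
  (forall x, U x -> f x = g x) -> smooth_on U f -> smooth_on U g.
Proof. by move=> oU fg fs k; exact: eq_class_C (fs k). Qed.

Lemma smooth_on_cst W U (w : W) : smooth_on U (fun=> w).
Proof.
move=> k; elim: k w => [|k IH] w /=; first by move=> x _; exact: cst_continuous.
split=> [x _|v]; first exact: differentiable_cst.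
have -> : (fun x : 'rV[R]_n => 'D_v (fun=> w) x) = fun=> 0.
  by apply: funext => x; rewrite derive_cst.
exact: IH.
Qed.

(** By the chain rule, the derivative of [L \o f] along [v] is [L] composed with that of [f], which
    has the same shape one order lower. *)
Lemma smooth_on_linear q W U (L : {linear 'rV[R]_q -> W})
    (f : 'rV[R]_n -> 'rV[R]_q) :
  open U -> smooth_on U f -> smooth_on U (L \o f).
Proof.
move=> oU fs k; have Lc : continuous L := @linear_rV_continuous _ _ _ L.
elim: k f fs => [|k IH] f fs /=.
  by move=> x /(fs 0%N) fc; apply: continuous_comp; [exact: fc|exact: Lc].
split=> [x /(smooth_on_diff fs) fd|v].
  by apply: differentiable_comp => //; exact: (linear_differentiable _ Lc).
apply: eq_class_C (IH _ (smooth_on_derive v fs)) => // x.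
move=> /(smooth_on_diff fs) fd /=.
have Ld := linear_differentiable (f x) Lc.
rewrite [RHS]deriveE; last exact: differentiable_comp.
by rewrite diff_comp //= diff_lin // deriveE.
Qed.

Lemma class_CD W U k (f g : 'rV[R]_n -> W) : open U ->
  class_C k U f -> class_C k U g -> class_C k U (fun x => f x + g x).
Proof.
move=> oU; elim: k f g => [|k IH] f g /=.
  by move=> fc gc x Ux; apply: continuousD; [exact: fc|exact: gc].
move=> [fd fD] [gd gD]; split=> [x Ux|v].
  by apply: differentiableD; [exact: fd|exact: gd].
apply: eq_class_C (IH _ _ (fD v) (gD v)) => // x Ux /=.
rewrite -deriveD //.
- by apply: diff_derivable; exact: fd.
- by apply: diff_derivable; exact: gd.
Qed.

Lemma smooth_onD W U (f g : 'rV[R]_n -> W) : open U ->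
  smooth_on U f -> smooth_on U g -> smooth_on U (fun x => f x + g x).
Proof. by move=> oU fs gs k; exact: class_CD. Qed.

(** The scalar is typed in [R^o], a normed module over [R], so that scaling carries a bilinear
    structure and the differentiation rule for bilinear maps applies. *)
Definition scale_of W (a : R^o) (w : W) : W := a *: w.

Lemma scale_is_bilinear W :
  bilinear_for
    (GRing.Scale.Law.clone _ _ *:%R _) (GRing.Scale.Law.clone _ _ *:%R _)
    (@scale_of W).
Proof.
split=> [u'|u] a x y; rewrite /= /scale_of.
- by rewrite scalerDl scalerA.
- by rewrite scalerDr !scalerA mulrC.
Qed.

HB.instance Definition _ W := bilinear_isBilinear.Build R R^o W W _ _
  (@scale_of W) (@scale_is_bilinear W).

(** The product rule: the chain rule for the pairing of [f] and [g] followed by the bilinear map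
    [scale_of]. *)
Lemma is_diff_scale W (f : 'rV[R]_n -> R^o) (g : 'rV[R]_n -> W) x :
  differentiable f x -> differentiable g x ->
  is_diff x (fun y => f y *: g y) (fun v => f x *: 'd g x v + 'd f x v *: g x).
Proof.
move=> fd gd.
pose B (p : R^o * W) : W := p.1 *: p.2.
have Bc : continuous B by move=> p; exact: scale_continuous.
have Bd : differentiable B (f x, g x).
  exact: (@differentiable_bilin _ _ _ _ (@scale_of W)).
have fgd := differentiable_pair fd gd.
split; first exact: (@differentiable_comp _ _ _ _ (fun y => (f y, g y)) B).
rewrite (diff_comp (f := fun y => (f y, g y)) (g := B)) // diff_pair //.
rewrite (@diff_bilin _ _ _ _ (@scale_of W)) //.
Qed.

(** The product rule writes the derivative as a sum of two products of smooth maps. Both factors are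
    kept smooth to all orders in the induction, so that an undifferentiated factor can be used again
    at the lower order. *)
Lemma smooth_onZ W U (f : 'rV[R]_n -> R^o) (g : 'rV[R]_n -> W) : open U ->
  smooth_on U f -> smooth_on U g -> smooth_on U (fun x => f x *: g x).
Proof.
move=> oU fs gs k; elim: k f fs g gs => [|k IH] f fs g gs /=.
  move=> x Ux; apply: (@continuousZ _ _ _ f g);
    [exact: (fs 0%N)|exact: (gs 0%N)].
split=> [x Ux|v].
  by have [] := is_diff_scale (smooth_on_diff fs Ux) (smooth_on_diff gs Ux).
have fDs := smooth_on_derive v fs; have gDs := smooth_on_derive v gs.
have IHD : class_C k U (fun x => f x *: 'D_v g x + 'D_v f x *: g x).
  by apply: class_CD => //; exact: IH.
apply: eq_class_C IHD => // x Ux.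
have [fgd fgE] := is_diff_scale (smooth_on_diff fs Ux) (smooth_on_diff gs Ux).
rewrite [RHS]deriveE //.
rewrite (deriveE v (smooth_on_diff fs Ux)) (deriveE v (smooth_on_diff gs Ux)).
by have /esym := congr1 (fun F => F v) fgE.
Qed.
End SmoothOn.

(** By the chain rule, differentiating [f \o L] along [v] gives the derivative of [f] along [L v],
    composed with [L]. *)
Lemma smooth_on_comp_linear (R : realType) n q (W : normedModType R)
    (L : {linear 'rV[R]_n -> 'rV[R]_q}) (U : set 'rV[R]_q) (f : 'rV[R]_q -> W) :
  open U -> smooth_on U f -> smooth_on (L @^-1` U) (f \o L).
Proof.
move=> oU fs k; have Lc : continuous L := @linear_rV_continuous _ _ _ L.
have oV : open (L @^-1` U) by apply: open_comp => // x _; exact: Lc.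
elim: k f fs => [|k IH] f fs /=.
  by move=> x /(fs 0%N) fc; apply: continuous_comp; [exact: Lc|exact: fc].
split=> [x /(smooth_on_diff fs) fd|v].
  by apply: differentiable_comp => //; exact: (linear_differentiable _ Lc).
apply: eq_class_C (IH _ (smooth_on_derive (L v) fs)) => // x.
move=> /(smooth_on_diff fs) fd /=.
have Ld := linear_differentiable x Lc.
rewrite [RHS]deriveE; last exact: differentiable_comp.
by rewrite diff_comp //= diff_lin // deriveE.
Qed.

(** * Open sets and smooth functions on a space with charts *)

Section SmoothFun.
Context {R : realType} {n : nat} {X : charted R n}.
Implicit Types (O : set X) (W : normedModType R).
(** The only manifold axiom assumed here; it holds for [M] by definition and is checked for the
    total space in [total_cmapK], so both are covered. *)
Hypothesis cmapK :
  forall c p, atlas X c -> cdom c p -> cinv c (cmap c p) = p.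

(** A chart is injective on its domain, so the image of the intersection is the intersection of the
    images. *)
Lemma mopenI O O' : mopen O -> mopen O' -> mopen (O `&` O').
Proof.
move=> oO oO' c hc.
have -> : cmap c @` (O `&` O' `&` cdom c) =
          cmap c @` (O `&` cdom c) `&` cmap c @` (O' `&` cdom c).
  apply/seteqP; split=> [_ [p [[Op Op2] cp] <-]|z]; first by split; exists p.
  case=> [[p [Op cp] <-]] [q [Oq cq] e]; exists p => //; split=> //; split=> //.
  by rewrite -(cmapK hc cp) -e (cmapK hc cq).
by apply: openI; [exact: oO|exact: oO'].
Qed.

Lemma smooth_fun_sub W O O' (f : X -> W) :
  O' `<=` O -> smooth_fun O f -> smooth_fun O' f.
Proof.
move=> sub fs c hc; apply: smooth_on_sub (fs c hc) => _ [p [Op cp] <-].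
by exists p => //; split=> //; exact: sub.
Qed.

Lemma eq_smooth_fun W O (f g : X -> W) : mopen O ->
  (forall p, O p -> f p = g p) -> smooth_fun O f -> smooth_fun O g.
Proof.
move=> oO fg fs c hc; apply: eq_smooth_on (fs c hc); first exact: oO.
by move=> _ [p [Op cp] <-] /=; rewrite (cmapK hc cp) fg.
Qed.

Lemma smooth_fun_cst W O (w : W) : smooth_fun O (fun=> w).
Proof. by move=> c hc; exact: smooth_on_cst. Qed.

Lemma smooth_funD W O (f g : X -> W) : mopen O ->
  smooth_fun O f -> smooth_fun O g -> smooth_fun O (fun p => f p + g p).
Proof.
move=> oO fs gs c hc.
by apply: (smooth_onD (oO c hc) (fs c hc) (gs c hc)).
Qed.

Lemma smooth_funZ W O (f : X -> R^o) (g : X -> W) : mopen O ->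
  smooth_fun O f -> smooth_fun O g -> smooth_fun O (fun p => f p *: g p).
Proof.
move=> oO fs gs c hc.
by apply: (smooth_onZ (oO c hc) (fs c hc) (gs c hc)).
Qed.

Lemma smooth_fun_linear q W O (L : {linear 'rV[R]_q -> W}) (f : X -> 'rV[R]_q) :
  mopen O -> smooth_fun O f -> smooth_fun O (L \o f).
Proof.
move=> oO fs c hc.
by apply: (smooth_on_linear L (oO c hc) (fs c hc)).
Qed.

End SmoothFun.

(** * The total space of E and its vertical tangent vectors *)

Section TotalSpace.
Context {R : realType} {m r : nat} {M : charted R m}.
Hypothesis hM : is_smooth_manifold M.
Context {E : vbundle M r}.
Hypothesis hE : is_vector_bundle E.
Local Notation TotE := (total_space E).
Local Notation proj := (@bproj R m r M E).

Lemma mopen_cdom c : atlas M c -> mopen (cdom c).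
Proof. by move=> hc c' hc'; exact: (mfd_open hM). Qed.

Lemma total_cmapK k (p : TotE) : atlas TotE k -> cdom k p ->
  cinv k (cmap k p) = p.
Proof.
move=> [c [t [hc ht ->]]]; case: p => x u [cx tx] /=.
rewrite row_mxKl row_mxKr -[in RHS](vb_vmapK hE u ht tx).
by rewrite /bproj /= (mfd_cmapK hM hc cx).
Qed.

(** In a total chart the projection is [lsubmx], and the fibre coordinates fill all of R^r; the
    chart image is therefore the preimage under [lsubmx] of an open set. *)
Lemma mopen_bproj (O : set M) : mopen O -> mopen (proj @^-1` O : set TotE).
Proof.
move=> oO k [c [t [hc ht ->]]].
have oU : open (cmap c @` (O `&` vdom t `&` cdom c)).
  by apply: mopenI => //; [exact: (mfd_cmapK hM)|exact: (vb_open hE)].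
have -> : cmap (total_chart c t) @`
    ((proj @^-1` O : set TotE) `&` cdom (total_chart c t)) =
    lsubmx @^-1` (cmap c @` (O `&` vdom t `&` cdom c)).
  apply/seteqP; split=> [_ [p [Op [cp tp]] <-]|z [x [[Ox tx] cx] e]] /=.
    by rewrite row_mxKl; exists (bproj p).
  (* The vector over [x] with fibre coordinates [rsubmx z] is the point of the total space mapped to
     [z]. *)
  exists (existT (fun x => E x) x (vinv t x (rsubmx z))) => //=.
  by rewrite (vb_vinvK hE) // /bproj /= e hsubmxK.
by apply: open_comp => // z _; exact: continuous_lsubmx.
Qed.

Lemma mopen_total_cdom c t : atlas M c -> vbatlas E t ->
  mopen (cdom (total_chart c t) : set TotE).
Proof.
move=> hc ht; apply: (@mopen_bproj (cdom c `&` vdom t)).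
by apply: mopenI; [exact: (mfd_cmapK hM)|exact: mopen_cdom|exact: (vb_open hE)].
Qed.

Lemma mopen_totalT : mopen (setT : set TotE).
Proof.
move=> k [c [t [hc ht ->]]].
(* The image of the whole space under a chart is by definition the image of the domain of that
   chart. *)
have := mopen_total_cdom hc ht; move=> /(_ (total_chart c t)).
rewrite setIid setTI; apply.
by exists c, t.
Qed.

Lemma smooth_fun_bproj (W : normedModType R) (O : set M) (f : M -> W) :
  mopen O -> smooth_fun O f ->
  smooth_fun (proj @^-1` O : set TotE) (f \o proj).
Proof.
move=> oO fs k [c [t [hc ht ->]]].
have := smooth_on_comp_linear (lsubmx : {linear 'rV[R]_(m + r) -> 'rV_m})
  (oO c hc) (fs c hc).
apply: smooth_on_sub => _ [p [Op [cp tp]] <-] /=.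
by rewrite row_mxKl; exists (bproj p).
Qed.

Lemma vinv_linear t x a v w : vbatlas E t -> vdom t x ->
  vinv t x (a *: v + w) = a *: vinv t x v + vinv t x w :> E x.
Proof.
move=> ht tx; rewrite -[RHS](vb_vmapK hE _ ht tx) (vb_linear hE) //.
by rewrite !(vb_vinvK hE).
Qed.

(** Moving in the direction of [row_mx 0 v] fixes the base point, and the change of coordinates is
    linear along the fibre. The difference quotient is thus constant for nonzero increments, and its
    limit is that constant. *)
Lemma coord_vec_vertE c t c' t' (p : TotE) v :
  atlas M c -> vbatlas E t -> atlas M c' -> vbatlas E t' ->
  cdom (total_chart c t) p -> cdom (total_chart c' t') p ->
  coord_vec (total_chart c t : chart R TotE _) p (row_mx 0 v)
    (total_chart c' t') = row_mx 0 (vmap t' (vinv t (bproj p) v)).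
Proof.
move=> hc ht hc' ht' [cx tx] [c2x t2x].
rewrite /coord_vec asboolT; last by split=> //; exists c', t'.
case: p => x u /= in cx tx c2x t2x *; rewrite /bproj /= in cx tx c2x t2x *.
set F := _ \o _; rewrite /derive.
apply: cvg_lim => //.
apply: (@cvg_trans _ ((fun=> row_mx 0 (vmap t' (vinv t x v))) @ 0^'));
  last exact: cvg_cst.
apply: near_eq_cvg; near=> d.
have d0 : d != 0 by near: d; exact: nbhs_dnbhs_neq.
rewrite /F /= scale_row_mx scaler0 add_row_mx add0r !row_mxKl !row_mxKr.
rewrite (mfd_cmapK hM hc cx) /bproj /=.
rewrite vinv_linear // (vb_linear hE) // opp_row_mx add_row_mx subrr.
by rewrite addrK scale_row_mx scaler0 scalerA mulVf // scale1r.
Unshelve. all: by end_near. Qed.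

Lemma atlas_total c t : atlas M c -> vbatlas E t ->
  atlas TotE (total_chart c t).
Proof. by move=> hc ht; exists c, t. Qed.

(** A tangent vector is its family of components. In the charts around [p] both sides are computed
    by [coord_vec_vertE]; in the other charts both vanish by convention. *)
Lemma coord_vec_vert_change c t c' t' (p : TotE) v :
  atlas M c -> vbatlas E t -> atlas M c' -> vbatlas E t' ->
  cdom (total_chart c t) p -> cdom (total_chart c' t') p ->
  coord_vec (total_chart c t : chart R TotE _) p (row_mx 0 v) =
  coord_vec (total_chart c' t' : chart R TotE _) p
    (row_mx 0 (vmap t' (vinv t (bproj p) v))).
Proof.
move=> hc ht hc' ht' kp k'p; apply: funext => k.
have [[]|nk] := pselect (atlas TotE k /\ cdom k p); last first.
  by rewrite /coord_vec !asboolF.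
move=> [c2 [t2 [hc2 ht2 ->]]] k2p.
rewrite !coord_vec_vertE // (vb_vmapK hE) //.
by case: k'p.
Qed.

(** * Sections of the generalized tangent bundle and vertical sections *)

Section Sections.
Context {h : diffeo M} {rho : forall x : M, E x -> tvec M}.
Local Notation gsection := (gsection E h).
Local Notation gtb_section := (@gtb_section R m r M E h rho).
Implicit Types (O : set TotE) (X Y : gsection).

Lemma mopen_vdom s : vbatlas E s ->
  mopen [set p : TotE | vdom s (h (bproj p))].
Proof.
move=> hs; apply: (@mopen_bproj (h @^-1` vdom s)).
by apply: (dmap_smooth h).1; exact: (vb_open hE).
Qed.

Lemma mopen_nat_dom c t s :
  nat_charts c t s -> mopen (nat_dom h c t s : set TotE).
Proof.
move=> [hc ht hs].
have -> : nat_dom h c t s =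
    cdom (total_chart c t) `&` [set p : TotE | vdom s (h (bproj p))].
  by apply/seteqP; split=> p; [case=> ? ? ?; split|case=> -[]].
apply: mopenI; [exact: total_cmapK|exact: mopen_total_cdom|exact: mopen_vdom].
Qed.

Lemma nat_domP (p : TotE) :
  exists c t s, nat_charts c t s /\ nat_dom h c t s p.
Proof.
have [c [hc cp]] := mfd_cover hM (bproj p).
have [t [ht tp]] := vb_cover hE (bproj p).
have [s [hs sp]] := vb_cover hE (h (bproj p)).
by exists c, t, s; split; split.
Qed.

(** [coord_vec] is defined by a derivative, so its linearity in the vertical vector is read off
    chart by chart from the formula of [coord_vec_vertE]. *)
Lemma sum_ddot c t (p : TotE) (y : 'I_r -> R) :
  atlas M c -> vbatlas E t -> cdom (total_chart c t) p ->
  \sum_(a < r) y a *: ddot h c t a p =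
  (0, coord_vec (total_chart c t : chart R TotE _) p
        (row_mx 0 (\row_a y a))).
Proof.
move=> hc ht kp; rewrite [LHS]surjective_pairing; congr pair.
  rewrite (big_morph fst (id1 := 0) (op1 := +%R)) // big1 // => a _.
  by rewrite /= scaler0.
rewrite (big_morph snd (id1 := 0) (op1 := +%R)) //.
apply: funext => k.
rewrite (big_morph (fun w : tvec TotE => w k) (id1 := 0) (op1 := +%R)) //.
have [[]|nk] := pselect (atlas TotE k /\ cdom k p); last first.
  rewrite /coord_vec asboolF // big1 // => a _.
  rewrite -[LHS]/(y a *: coord_vec (total_chart c t : chart R TotE _) p _ k).
  by rewrite /coord_vec asboolF // scaler0.
move=> [c2 [t2 [hc2 ht2 ->]]] k2p.
rewrite coord_vec_vertE //.
set x := bproj p.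
(* The component formula is packaged as a linear map, so that it commutes with the expansion of the
   row [y] in the standard basis. *)
have Ll : linear (fun v => row_mx (0 : 'rV[R]_m) (vmap t2 (vinv t x v))).
  move=> e v w; case: kp k2p => _ tx [_ t2x].
  rewrite vinv_linear // (vb_linear hE) //.
  by rewrite scale_row_mx scaler0 add_row_mx addr0.
pose L : {linear 'rV[R]_r -> 'rV[R]_(m + r)} :=
  HB.pack (fun v => row_mx (0 : 'rV[R]_m) (vmap t2 (vinv t x v)))
    (GRing.isLinear.Build _ _ _ _ _ Ll).
rewrite -[RHS]/(L _) [\row_a y a]row_sum_delta linear_sum.
apply: eq_bigr => a _; rewrite mxE.
rewrite -[LHS]/(y a *: coord_vec (total_chart c t : chart R TotE _) p _ _).
by rewrite coord_vec_vertE // linearZ.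
Qed.

(** Verticality is defined by a condition in every natural base around [p]. A single base is enough
    to test it, because [coord_vec_vert_change] rewrites vertical vectors from one base to
    another. *)
Lemma verticalP c t s (p : TotE) (z : E (h (bproj p)) * tvec TotE) :
  nat_charts c t s -> nat_dom h c t s p ->
  vertical z <-> exists v,
    z = (0, coord_vec (total_chart c t : chart R TotE _) p (row_mx 0 v)).
Proof.
move=> hn np; have [hc ht hs] := hn; have [cp tp sp] := np; split.
  move=> /(_ _ _ _ hn np) [y ->]; rewrite sum_ddot //.
  by exists (\row_a y a).
move=> [v ->] c' t' s' [hc' ht' hs'] [c'p t'p _].
rewrite (coord_vec_vert_change (c' := c') (t' := t')) //.
(* The coefficients in the new base are the coordinates in [t'] of the fibre vector that has
   coordinates [v] in [t]. *)
exists (fun b => vmap t' (vinv t (bproj p) v) 0 b).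
rewrite sum_ddot //; congr (_, coord_vec _ _ (row_mx _ _)).
by apply/rowP => b; rewrite mxE.
Qed.

Lemma vertical_ddot c t s a (p : TotE) : nat_charts c t s ->
  nat_dom h c t s p -> vertical (ddot h c t a p).
Proof. by move=> hn np; apply/(verticalP _ hn np); exists (delta_mx 0 a). Qed.

Lemma verticalD (p : TotE) (a : R) (z w : E (h (bproj p)) * tvec TotE) :
  vertical z -> vertical w -> vertical (a *: z + w).
Proof.
move=> hz hw c t s hn np.
have [y ->] := hz _ _ _ hn np; have [y' ->] := hw _ _ _ hn np.
exists (fun b => a * y b + y' b).
rewrite scaler_sumr -big_split; apply: eq_bigr => b _ /=.
by rewrite scalerA scalerDl.
Qed.

Lemma gtbD (p : TotE) (a : R) (z w : E (h (bproj p)) * tvec TotE) :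
  gtb rho z -> gtb rho w -> gtb rho (a *: z + w).
Proof.
move=> hz hw c t s hn np.
have [x [y ->]] := hz _ _ _ hn np; have [x' [y' ->]] := hw _ _ _ hn np.
exists (fun b => a * x b + x' b), (fun b => a * y b + y' b).
rewrite scalerDr addrACA !scaler_sumr -2!big_split.
by congr (_ + _); apply: eq_bigr => b _ /=; rewrite scalerA scalerDl.
Qed.

Lemma vertical_gtb (p : TotE) (z : E (h (bproj p)) * tvec TotE) :
  vertical z -> gtb rho z.
Proof.
move=> hz c t s hn np; have [y ->] := hz _ _ _ hn np.
exists (fun=> 0), y; rewrite [X in X + _]big1 ?add0r // => a _.
by rewrite scale0r.
Qed.

Lemma vertical0 (p : TotE) : vertical (0 : E (h (bproj p)) * tvec TotE).
Proof.
move=> c t s hn np; exists (fun=> 0); rewrite big1 // => a _.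
by rewrite scale0r.
Qed.

Lemma gtb_section_sub O O' X : O' `<=` O -> gtb_section O X -> gtb_section O' X.
Proof.
move=> sub [X1 X2 X3]; split=> [p /sub /X1//|s hs|k hk].
  by apply: smooth_fun_sub (X2 s hs) => p [/sub].
by apply: smooth_fun_sub (X3 k hk) => p [/sub].
Qed.

(** Multiples by smooth functions (with [Y] zero) and sums (with [f] constantly 1) are both
    instances. *)
Lemma gtb_sectionZD O (f : TotE -> R^o) X Y : mopen O -> smooth_fun O f ->
  gtb_section O X -> gtb_section O Y ->
  gtb_section O (fun p => f p *: X p + Y p).
Proof.
move=> oO fs [X1 X2 X3] [Y1 Y2 Y3]; split=> [p Op|s hs|k hk].
- by apply: gtbD; [exact: X1|exact: Y1].
- have oU : mopen (O `&` [set p : TotE | vdom s (h (bproj p))]).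
    by apply: mopenI; [exact: total_cmapK|exact: oO|exact: mopen_vdom].
  apply: (@eq_smooth_fun _ _ TotE total_cmapK _ _
    (fun p : TotE => f p *: vmap s (X p).1 + vmap s (Y p).1)) => //.
    by move=> p [Op sp] /=; rewrite (vb_linear hE).
  apply: smooth_funD => //; last exact: Y2.
  apply: smooth_funZ => //; last exact: X2.
  by apply: smooth_fun_sub fs => p [].
- have oU : mopen (O `&` cdom k).
    apply: mopenI; [exact: total_cmapK|exact: oO|].
    by case: hk => c [t [hc ht ->]]; exact: mopen_total_cdom.
  apply: (@smooth_funD _ _ TotE _ _
    (fun p : TotE => f p *: (X p).2 k) (fun p => (Y p).2 k)) => //;
    last exact: Y3.
  apply: smooth_funZ => //; last exact: X3.
  by apply: smooth_fun_sub fs => p [].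
Qed.

Lemma smooth_fun_vmap0 O s : mopen O -> vbatlas E s ->
  smooth_fun (O `&` [set p : TotE | vdom s (h (bproj p))])
    (fun p : TotE => vmap s (0 : E (h (bproj p)))).
Proof.
move=> oO hs; apply: (@eq_smooth_fun _ _ TotE total_cmapK _ _ (fun=> 0)).
- by apply: mopenI; [exact: total_cmapK|exact: oO|exact: mopen_vdom].
- move=> p [Op sp].
  (* Linearity of [vmap s] is available only over [vdom s], in the form of a combination; with
     coefficient -1 and both vectors zero it gives value 0. *)
  have := vb_linear hE (-1) (0 : E (h (bproj p))) 0 hs sp.
  by rewrite scaler0 addr0 scaleN1r addNr => ->.
- exact: smooth_fun_cst.
Qed.

Lemma gtb_section0 O : mopen O -> gtb_section O (fun=> 0).
Proof.
move=> oO; split=> [p Op|s hs|k hk].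
- by apply: vertical_gtb; exact: vertical0.
- exact: smooth_fun_vmap0.
- exact: smooth_fun_cst.
Qed.

Lemma gtb_section_sum (I : Type) (s : seq I) O (f : I -> TotE -> R^o)
    (F : I -> gsection) : mopen O ->
  (forall i, smooth_fun O (f i)) -> (forall i, gtb_section O (F i)) ->
  gtb_section O (fun q => \sum_(i <- s) f i q *: F i q).
Proof.
move=> oO hf hF; elim: s => [|i s IH].
  have -> : (fun q => \sum_(i <- [::]) f i q *: F i q) = (fun=> 0).
    by apply: functional_extensionality_dep => q; rewrite big_nil.
  exact: gtb_section0.
have -> : (fun q => \sum_(j <- i :: s) f j q *: F j q) =
    (fun q => f i q *: F i q + \sum_(j <- s) f j q *: F j q).
  by apply: functional_extensionality_dep => q; rewrite big_cons.
exact: gtb_sectionZD.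
Qed.

(** In another total chart the base components are 0 and the fibre components are the transition map
    applied to a basis vector, a smooth function on the base by [vb_smooth]. *)
Lemma gtb_section_ddot c t s a : nat_charts c t s ->
  gtb_section (nat_dom h c t s) (ddot h c t a).
Proof.
move=> hn; have [hc ht hs] := hn; have oN := mopen_nat_dom hn.
split=> [p np|s' hs'|k [c' [t' [hc' ht' ->]]]].
- by apply: vertical_gtb; exact: vertical_ddot np.
- exact: smooth_fun_vmap0.
have oU : mopen (nat_dom h c t s `&` cdom (total_chart c' t')).
  by apply: mopenI; [exact: total_cmapK|exact: oN|exact: mopen_total_cdom].
pose g x := vmap t' (vinv t x (delta_mx 0 a)).
(* Right multiplication by [A] puts a row of R^r into the fibre coordinates of R^(m + r). *)
pose A : 'M[R]_(r, m + r) := row_mx 0 1%:M.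
apply: (@eq_smooth_fun _ _ TotE total_cmapK _ _
  (mulmxr A \o (g \o proj))) => //.
  move=> p [[cp tp sp] kp].
  by rewrite [RHS]coord_vec_vertE //= mul_mx_row mulmx0 mulmx1.
apply: smooth_fun_linear => //.
have oV : mopen (vdom t `&` vdom t').
  by apply: mopenI; [exact: (mfd_cmapK hM)|exact: (vb_open hE)..].
apply: smooth_fun_sub (smooth_fun_bproj oV (vb_smooth hE _ ht ht')).
by move=> p [[_ tp _] [_ t'p]]; split.
Qed.

(** The component of [X p] along d/dy^a in the total chart. It is defined for every section; for a
    vertical one it is the coefficient of [ddot] by [vcoefE]. *)
Definition vcoef c t (X : gsection) (a : 'I_r) (p : TotE) : R^o :=
  (X p).2 (total_chart c t) 0 (rshift m a).

Lemma vcoefE c t s X (p : TotE) : nat_charts c t s -> nat_dom h c t s p ->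
  vertical (X p) -> X p = \sum_(a < r) vcoef c t X a p *: ddot h c t a p.
Proof.
move=> hn np /(verticalP _ hn np) [v Xv].
have [hc ht hs] := hn; have [cp tp sp] := np.
rewrite sum_ddot // Xv; congr (_, coord_vec _ _ (row_mx _ _)).
apply/rowP => a; rewrite mxE /vcoef Xv /= coord_vec_vertE // row_mxEr.
by rewrite (vb_vinvK hE).
Qed.

Lemma smooth_vcoef c t O X a : atlas M c -> vbatlas E t -> mopen O ->
  O `<=` cdom (total_chart c t) -> gtb_section O X ->
  smooth_fun O (vcoef c t X a).
Proof.
move=> hc ht oO sub [_ _ X3].
have Ll : linear (fun w : 'rV[R]_(m + r) => w 0 (rshift m a) : R^o).
  by move=> e v w; rewrite !mxE.
pose L : {linear 'rV[R]_(m + r) -> R^o} :=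
  HB.pack (fun w : 'rV[R]_(m + r) => w 0 (rshift m a) : R^o)
    (GRing.isLinear.Build _ _ _ _ _ Ll).
apply: (smooth_fun_linear L (f := fun p => (X p).2 (total_chart c t))) => //.
apply: smooth_fun_sub (X3 _ (atlas_total hc ht)).
by move=> p Op; split=> //; exact: sub.
Qed.

(** * Involutivity of the vertical subbundle *)

Section Bracket.
Context {brE : (forall x : M, E x) -> (forall x : M, E x) -> forall x : M, E x}.
Context {br : gsection -> gsection -> gsection}.
Hypothesis hbr : is_gtb_bracket rho brE br.

(** Linearity in the first argument is carried to the second by skew symmetry. *)
Lemma br_linr O a X X' Y p : mopen O ->
  gtb_section O X -> gtb_section O X' -> gtb_section O Y -> O p ->
  br Y (fun q => a *: X q + X' q) p = a *: br Y X p + br Y X' p.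
Proof.
move=> oO hX hX' hY Op.
have hS : gtb_section O (fun q => a *: X q + X' q).
  by apply: (gtb_sectionZD (f := fun=> a)) => //; exact: smooth_fun_cst.
rewrite !(gbr_skew hbr oO hY _ Op) // (gbr_bilinear hbr _ oO) //.
by rewrite opprD scalerN.
Qed.

(** By the Leibniz rule each summand contributes [f i p] times the bracket of [Y] with [F i], plus a
    multiple of [F i p]. Both are vertical at [p], the one point where verticality is assumed. *)
Lemma br_sum_vertical (I : Type) (s : seq I) O (f : I -> TotE -> R^o)
    (F : I -> gsection) Y p : mopen O -> O p -> gtb_section O Y ->
  (forall i, smooth_fun O (f i)) -> (forall i, gtb_section O (F i)) ->
  (forall i, vertical (F i p)) -> (forall i, vertical (br Y (F i) p)) ->
  vertical (br Y (fun q => \sum_(i <- s) f i q *: F i q) p).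
Proof.
move=> oO Op hY hf hF Fv brv.
elim: s => [|i s IH].
  have -> : (fun q => \sum_(i <- [::]) f i q *: F i q) = (fun=> 0).
    by apply: functional_extensionality_dep => q; rewrite big_nil.
  have h0 := gtb_section0 oO.
  (* Linearity with coefficient 1 and both sections zero says that the bracket of [Y] with 0 equals
     twice itself, hence vanishes. *)
  have := br_linr 1 oO h0 h0 hY Op; rewrite scale1r.
  have -> : (fun q : TotE => 1 *: (0 : E (h (bproj q)) * tvec TotE) + 0) =
            (fun=> 0).
    by apply: functional_extensionality_dep => q; rewrite scaler0 addr0.
  move/eqP; rewrite -subr_eq subrr eq_sym => /eqP ->; exact: vertical0.
have h1 : gtb_section O (fun q => f i q *: F i q).
  have -> : (fun q => f i q *: F i q) = (fun q => f i q *: F i q + 0).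
    by apply: functional_extensionality_dep => q; rewrite addr0.
  by apply: gtb_sectionZD => //; exact: gtb_section0.
have -> : (fun q => \sum_(j <- i :: s) f j q *: F j q) =
    (fun q => 1 *: (f i q *: F i q) + \sum_(j <- s) f j q *: F j q).
  by apply: functional_extensionality_dep => q; rewrite big_cons scale1r.
rewrite (br_linr _ oO) //; last exact: gtb_section_sum.
rewrite scale1r (gbr_leibniz hbr oO) // -addrA.
by apply: verticalD => //; exact: verticalD.
Qed.

Lemma vertical_br X Y : gtb_section setT X -> gtb_section setT Y ->
  (forall p, vertical (X p)) -> (forall p, vertical (Y p)) ->
  forall p, vertical (br X Y p).
Proof.
move=> hX hY Xv Yv p; have [c [t [s [hn np]]]] := nat_domP p.
have [hc ht hs] := hn.
set O := nat_dom h c t s; have oO : mopen O by exact: mopen_nat_dom.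
have Osub : O `<=` cdom (total_chart c t) by move=> q [].
have hXO : gtb_section O X by apply: gtb_section_sub hX.
have hYO : gtb_section O Y by apply: gtb_section_sub hY.
have hd a : gtb_section O (ddot h c t a) := gtb_section_ddot a hn.
have dv a : vertical (ddot h c t a p) by exact: vertical_ddot np.
(* The given sections coincide with these expansions on [O], and locality of the bracket allows the
   replacement. *)
pose X' : gsection := fun q => \sum_(a < r) vcoef c t X a q *: ddot h c t a q.
pose Y' : gsection := fun q => \sum_(a < r) vcoef c t Y a q *: ddot h c t a q.
rewrite (gbr_local hbr (X' := X') (Y' := Y') oO) //; first last.
- by move=> q Oq; exact: (vcoefE hn).
- by move=> q Oq; exact: (vcoefE hn).
(* Two passes: [X'] is expanded first, in its bracket with each frame section; then [Y'] is expanded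
   in its bracket with [X'], where skew symmetry brings back the first pass. *)
have brv b : vertical (br (ddot h c t b) X' p).
  apply: (br_sum_vertical _ oO np (hd b) _ hd dv _) => a.
    exact: smooth_vcoef.
  by rewrite (gbr_ddot hbr _ _ hn np); exact: vertical0.
have hX' : gtb_section O X'.
  by apply: gtb_section_sum => // a; exact: smooth_vcoef.
apply: (br_sum_vertical _ oO np hX' _ hd dv _) => b; first exact: smooth_vcoef.
rewrite (gbr_skew hbr oO hX' (hd b) np) -scaleN1r -[_ *: _]addr0.
by apply: verticalD => //; exact: vertical0.
Qed.

End Bracket.

(** * The two projectors and the splitting of the covariant derivative *)

Section Connection.
Context {G : forall p : TotE, E (h (bproj p)) * tvec TotE ->
  E (h (bproj p)) * tvec TotE}.
Hypothesis hG : is_connection rho G.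

Lemma gtb_section_hproj X :
  gtb_section setT X -> gtb_section setT (hproj G X).
Proof.
move=> hX.
have -> : hproj G X = (fun p => -1 *: G (X p) + X p).
  by apply: functional_extensionality_dep => p; rewrite scaleN1r addrC.
apply: (gtb_sectionZD (f := fun=> -1)) => //.
- exact: mopen_totalT.
- exact: smooth_fun_cst.
- by apply: (conn_smooth hG) => //; exact: mopen_totalT.
Qed.

(** Subtracting X - G X from X leaves G X: the vertical projector is the connection itself. *)
Lemma vprojE X : vproj G X = (fun p => G (X p)).
Proof.
by apply: functional_extensionality_dep => p; rewrite /vproj /hproj subKr.
Qed.

Lemma gtb_section_vproj X :
  gtb_section setT X -> gtb_section setT (vproj G X).
Proof.
move=> hX; rewrite vprojE; apply: (conn_smooth hG) => //.
exact: mopen_totalT.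
Qed.

Lemma vertical_vproj X p : gtb_section setT X -> vertical (vproj G X p).
Proof.
by move=> [gX _ _]; rewrite vprojE; apply: (conn_vertical hG); exact: gX.
Qed.

Lemma vproj_id X : (forall p, vertical (X p)) -> vproj G X = X.
Proof.
move=> Xv; rewrite vprojE; apply: functional_extensionality_dep => p.
exact: (conn_split hG).
Qed.

Context {D : gsection -> gsection -> gsection}.
Hypothesis hD : is_distinguished rho G D.

(** Additivity in the lower argument is linearity over functions for the constant function 1,
    applied to the sum of the two projections of [X]. *)
Lemma covariant_hproj_vproj X Y p : gtb_section setT X -> gtb_section setT Y ->
  D X Y p = D (hproj G X) Y p + D (vproj G X) Y p.
Proof.
move=> hX hY.
rewrite -[D (hproj G X) Y p]scale1r -(dl_linear hD (f := fun=> 1)) //.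
- suff -> : (fun q => 1 *: hproj G X q + vproj G X q) = X by [].
  apply: functional_extensionality_dep => q.
  by rewrite scale1r /vproj addrC subrK.
- exact: smooth_fun_cst.
- exact: gtb_section_hproj.
- exact: gtb_section_vproj.
Qed.

End Connection.

End Sections.
End TotalSpace.

Theorem theorem3p9 (R : realType) (m r : nat)
  (M : charted R m) (hM : is_smooth_manifold M)
  (E : vbundle M r) (hE : is_vector_bundle E)
  (h eta : diffeo M)
  (rho : forall x : M, E x -> tvec M)
  (brE : (forall x : M, E x) -> (forall x : M, E x) -> forall x : M, E x)
  (hA : is_gen_lie_algebroid h eta rho brE)
  (br : gsection E h -> gsection E h -> gsection E h)
  (hbr : is_gtb_bracket rho brE br)
  (G : forall p : total_space E,
     (E (h (bproj p)) * tvec (total_space E))%type ->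
     (E (h (bproj p)) * tvec (total_space E))%type)
  (hG : is_connection rho G)
  (D : gsection E h -> gsection E h -> gsection E h)
  (hD : is_distinguished rho G D)
  (X Y Z : gsection E h)
  (hX : gtb_section rho setT X)
  (hY : gtb_section rho setT Y)
  (hZ : gtb_section rho setT Z) :
  let H := hproj G in
  let V := vproj G in
  let RR := curvature br D in
  (forall p, D (H X) (D (H Y) (H Z)) p - D (H Y) (D (H X) (H Z)) p
     = RR (H X) (H Y) (H Z) p
       + D (H (br (H X) (H Y))) (H Z) p + D (V (br (H X) (H Y))) (H Z) p) /\
  (forall p, D (V X) (D (H Y) (H Z)) p - D (H Y) (D (V X) (H Z)) p
     = RR (V X) (H Y) (H Z) p
       + D (H (br (V X) (H Y))) (H Z) p + D (V (br (V X) (H Y))) (H Z) p) /\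
  (forall p, D (V X) (D (V Y) (H Z)) p - D (V Y) (D (V X) (H Z)) p
     = RR (V X) (V Y) (H Z) p
       + D (V (br (V X) (V Y))) (H Z) p) /\
  (forall p, D (H X) (D (H Y) (V Z)) p - D (H Y) (D (H X) (V Z)) p
     = RR (H X) (H Y) (V Z) p
       + D (H (br (H X) (H Y))) (V Z) p + D (V (br (H X) (H Y))) (V Z) p) /\
  (forall p, D (V X) (D (H Y) (V Z)) p - D (H Y) (D (V X) (V Z)) p
     = RR (V X) (H Y) (V Z) p
       + D (H (br (V X) (H Y))) (V Z) p + D (V (br (V X) (H Y))) (V Z) p) /\
  (forall p, D (V X) (D (V Y) (V Z)) p - D (V Y) (D (V X) (V Z)) p
     = RR (V X) (V Y) (V Z) p
       + D (V (br (V X) (V Y))) (V Z) p).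
Proof.
have oT := mopen_totalT hM hE.
have hHX := gtb_section_hproj hM hE hG hX.
have hHY := gtb_section_hproj hM hE hG hY.
have hHZ := gtb_section_hproj hM hE hG hZ.
have hVX := gtb_section_vproj hM hE hG hX.
have hVY := gtb_section_vproj hM hE hG hY.
have hVZ := gtb_section_vproj hM hE hG hZ.
(* The common form of the four identities involving [H X] or [H Y]. The two last terms recombine to
   the derivative along the bracket, which cancels the one subtracted in the curvature. *)
have split_bracket A B C : gtb_section rho setT A -> gtb_section rho setT B ->
    gtb_section rho setT C -> forall p, D A (D B C) p - D B (D A C) p =
    curvature br D A B C p + D (hproj G (br A B)) C p
      + D (vproj G (br A B)) C p.
  move=> hA1 hB hC p.
  rewrite -addrA -(covariant_hproj_vproj hM hE hG hD) ?subrK //.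
  exact: (gbr_sec hbr).
(* For two vertical arguments the bracket is vertical, hence fixed by the vertical projector, and
   the single remaining term is already the derivative along the whole bracket. *)
have split_vertical C : gtb_section rho setT C -> forall p,
    D (vproj G X) (D (vproj G Y) C) p - D (vproj G Y) (D (vproj G X) C) p =
    curvature br D (vproj G X) (vproj G Y) C p
      + D (vproj G (br (vproj G X) (vproj G Y))) C p.
  move=> hC p; rewrite (vproj_id hG (X := br _ _)) ?subrK //.
  by apply: (vertical_br hM hE hbr) => // q; exact: (vertical_vproj hG).
by do !(split; first by
  [exact: split_bracket | exact: split_vertical]); exact: split_vertical.
Qed.
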